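(* Let $\{\mathcal{T}(t)\}_{t\in[t_n,t_{n+1}]}$ be a moving simplicial mesh with cells $K_i(t)$ and mesh velocity $\mathbf{w}$, and suppose the piecewise polynomial discrete solution $\mathbf{u}$ satisfies the time-integrated ALE DG scheme $$\int_{K_i(t_{n+1})}\mathbf{u}(\mathbf{x},t_{n+1})\,\phi_m(\mathbf{x},t_{n+1})\,d\mathbf{x}-\int_{K_i(t_n)}\mathbf{u}(\mathbf{x},t_n)\,\phi_m(\mathbf{x},t_n)\,d\mathbf{x}=\int_{t_n}^{t_{n+1}}\!\!\int_{K_i(t)}\mathcal{G}(\mathbf{x},t,\mathbf{u},\mathbf{w})\cdot\nabla_{\mathbf{x}}\phi_m(\mathbf{x},t)\,d\mathbf{x}\,dt-\int_{t_n}^{t_{n+1}}\!\!\int_{\partial K_i(t)}\mathcal{H}(\mathbf{x},t,\mathbf{u}^-,\mathbf{u}^+,\mathbf{w};\boldsymbol{\nu})\,\phi_m\,ds\,dt$$ for every cell $K_i$ and every basis index $m$. Then the scheme is conservative, in the following sense. Taking $m=0$, for every cell $K_i$, $$\int_{K_i(t_{n+1})}\mathbf{u}(\mathbf{x},t_{n+1})\,d\mathbf{x}-\int_{K_i(t_n)}\mathbf{u}(\mathbf{x},t_n)\,d\mathbf{x}=-\int_{t_n}^{t_{n+1}}\!\!\int_{\partial K_i(t)}\mathcal{H}(\mathbf{x},t,\mathbf{u}^-,\mathbf{u}^+,\mathbf{w};\boldsymbol{\nu})\,ds\,dt ,$$ and, summing over all cells, $$\sum_{K_i}\int_{K_i(t_{n+1})}\mathbf{u}(\mathbf{x},t_{n+1})\,d\mathbf{x}-\sum_{K_i}\int_{K_i(t_n)}\mathbf{u}(\mathbf{x},t_n)\,d\mathbf{x}=-\sum_{K_i}\int_{t_n}^{t_{n+1}}\!\!\int_{\partial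 K_i(t)}\mathcal{H}(\mathbf{x},t,\mathbf{u}^-,\mathbf{u}^+,\mathbf{w};\boldsymbol{\nu})\,ds\,dt ,$$ where, on a face $K_i\cap K_j$ shared by two cells, the numerical fluxes seen from the two cells are opposite: $$\mathcal{H}_{K_i}(\mathbf{x},t,\mathbf{u}^-,\mathbf{u}^+,\mathbf{w};\boldsymbol{\nu})=-\mathcal{H}_{K_j}(\mathbf{x},t,\mathbf{u}^-,\mathbf{u}^+,\mathbf{w};-\boldsymbol{\nu}).$$
   Context: Conservation law: $\partial_t\mathbf{u}+\nabla_{\mathbf{x}}\cdot\mathcal{F}(\mathbf{x},t,\mathbf{u})=0$ with $\mathbf{u}\in\mathbb{R}^N$ and flux $\mathcal{F}=(\mathbf{F}_1,\dots,\mathbf{F}_d)$, $\mathbf{F}_i(\mathbf{x},t,\mathbf{u})\in\mathbb{R}^N$, on a moving domain $\Omega(t)\subset\mathbb{R}^d$. Moving mesh: $\mathcal{T}(t)$ is a simplicial mesh of $\Omega(t)$ with finitely many cells $K_i(t)$ and with fixed connectivity on $[t_n,t_{n+1}]$. Each vertex moves with a velocity constant in time on $[t_n,t_{n+1}]$, and all cells remain positively oriented. In each cell the mesh velocity $\mathbf{w}(\mathbf{x},t)\in\mathbb{R}^d$ is the barycentric (affine) interpolation of the velocities of the $d+1$ vertices of the cell, so each cell $K(t)$ is the image of a fixed reference simplex $\hat K$ under a time-dependent affine map $\boldsymbol{\xi}\mapsto\mathbf{x}(\boldsymbol{\xi},t)$ with $\partial_t\mathbf{x}(\boldsymbol{\xi},t)=\mathbf{w}(\mathbf{x}(\boldsymbol{\xi},t),t)$.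 Basis: fix $k\ge0$ and a basis $\hat\phi_0,\hat\phi_1,\dots$ of the polynomials of degree at most $k$ on $\hat K$, orthonormal in $L^2(\hat K)$, with $\hat\phi_0$ a nonzero constant. On $K(t)$ set $\phi_m(\mathbf{x}(\boldsymbol{\xi},t),t)=\hat\phi_m(\boldsymbol{\xi})$. The discrete solution is, on each cell, $\mathbf{u}(\mathbf{x},t)=\sum_m\mathbf{u}_m(t)\phi_m(\mathbf{x},t)$ with $\mathbf{u}_m(t)\in\mathbb{R}^N$. Fluxes: the ALE flux is $\mathcal{G}(\mathbf{x},t,\mathbf{u},\mathbf{w})=\mathcal{F}(\mathbf{x},t,\mathbf{u})-\mathbf{u}\otimes\mathbf{w}$, i.e. $\mathcal{G}\cdot\mathbf{v}=\sum_{i=1}^d(\mathbf{F}_i(\mathbf{x},t,\mathbf{u})-w_i\mathbf{u})v_i$ for $\mathbf{v}\in\mathbb{R}^d$. The numerical flux $\mathcal{H}(\mathbf{x},t,\mathbf{u}^-,\mathbf{u}^+,\mathbf{w};\boldsymbol{\nu})\in\mathbb{R}^N$ is consistent, $\mathcal{H}(\mathbf{x},t,\mathbf{u},\mathbf{u},\mathbf{w};\boldsymbol{\nu})=\mathcal{G}(\mathbf{x},t,\mathbf{u},\mathbf{w})\cdot\boldsymbol{\nu}$, and satisfies $\mathcal{H}(\mathbf{x},t,\mathbf{u}^-,\mathbf{u}^+,\mathbf{w};\boldsymbol{\nu})=-\mathcal{H}(\mathbf{x},t,\mathbf{u}^+,\mathbf{u}^-,\mathbf{w};-\boldsymbol{\nu})$.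 In an integral over $\partial K_i(t)$, $\boldsymbol{\nu}$ is the outward unit normal to $K_i(t)$ and $\mathbf{u}^-$, $\mathbf{u}^+$ are the values of $\mathbf{u}$ from inside and outside $K_i(t)$ (on faces lying on the domain boundary, $\mathbf{u}^+$ is whatever outside value the scheme uses there; no particular boundary condition is specified). A subscript, as in $\mathcal{H}_{K_i}$ and $\mathcal{H}_{K_j}$, indicates the cell with respect to which the inside value $\mathbf{u}^-$ and the outside value $\mathbf{u}^+$ are taken; on the shared face $\boldsymbol{\nu}$ is outward from $K_i$, so $-\boldsymbol{\nu}$ is outward from $K_j$. *)

(* Defs.v *)
From HB Require Import structures.
From mathcomp Require Import all_boot all_order all_algebra.
From mathcomp Require Import all_classical all_reals all_analysis.
From mathcomp Require mpoly.
Set Implicit Arguments.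
Unset Strict Implicit.
Unset Printing Implicit Defensive.
Import Order.TTheory GRing.Theory Num.Theory.
Import numFieldNormedType.Exports.
Local Open Scope classical_set_scope.
Local Open Scope ring_scope.

(* The n-dimensional Lebesgue measure is built on n.-tuple R, which carries the
   product sigma-algebra in the library; points of R^n are row vectors. *)
Section LebesgueMeasure.
Context {R : realType}.
Local Notation mR := (measurableTypeR R).

Definition cons_pair n (p : mR * n.-tuple mR) : n.+1.-tuple mR :=
  [tuple of p.1 :: p.2].

Lemma measurable_cons_pair n : measurable_fun setT (@cons_pair n).
Proof. exact: measurable_cons. Qed.

Lemma measurable_uncons n (A : set mR) (B : set (n.-tuple mR)) :
  measurable A -> measurable B ->
  measurable [set y : n.+1.-tuple mR | A (thead y) /\ B [tuple of behead y]].
Proof.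
move=> mA mB.
have m1 : measurable ((fun y : n.+1.-tuple mR => thead y) @^-1` A).
  have := @measurable_tnth _ mR n.+1 ord0 measurableT _ mA.
  by rewrite setTI.
have m2 : measurable ((fun y : n.+1.-tuple mR => [tuple of behead y]) @^-1` B).
  have := @measurable_behead _ mR n measurableT _ mB.
  by rewrite setTI.
exact: measurableI m1 m2.
Qed.

Section Step.
Variables (n : nat) (mu : {sigma_finite_measure set (n.-tuple mR) -> \bar R}).

Definition lebesgue_cons : set (n.+1.-tuple mR) -> \bar R :=
  pushforward (lebesgue_measure \x mu)%E (@cons_pair n).

Let lebesgue_cons0 : lebesgue_cons set0 = 0%E.
Proof. by rewrite /lebesgue_cons /pushforward preimage_set0 measure0. Qed.

Let pf : {measure set (n.+1.-tuple mR) -> \bar R} :=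
  measure_function_pushforward__canonical__measure_function_Measure
    (product_measure1 lebesgue_measure mu) (@measurable_cons_pair n).

Let lebesgue_cons_ge0 A : (0 <= lebesgue_cons A)%E.
Proof. exact: (measure_ge0 pf). Qed.

Let lebesgue_cons_sigma_additive : semi_sigma_additive lebesgue_cons.
Proof. exact: (@measure_semi_sigma_additive _ _ _ pf). Qed.

HB.instance Definition _ := isMeasure.Build _ _ _ lebesgue_cons
  lebesgue_cons0 lebesgue_cons_ge0 lebesgue_cons_sigma_additive.

Lemma lebesgue_consX (A : set mR) (B : set (n.-tuple mR)) :
  measurable A -> measurable B ->
  lebesgue_cons [set y | A (thead y) /\ B [tuple of behead y]] =
  (lebesgue_measure A * mu B)%E.
Proof.
move=> mA mB; rewrite -product_measure1E// /lebesgue_cons /pushforward.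
congr product_measure1; apply/seteqP; split => -[x y] /=.
  move=> -[Ax By]; split => //.
  suff <- : [tuple of behead (cons_pair (x, y))] = y by [].
  exact/val_inj.
move=> -[Ax By]; split => //.
suff -> : [tuple of behead (cons_pair (x, y))] = y by [].
exact/val_inj.
Qed.

Let lebesgue_cons_sigma_finite : sigma_finite setT lebesgue_cons.
Proof.
have /sigma_finiteP[F [TF ndF Foo]] := sigma_finiteT (@lebesgue_measure R).
have /sigma_finiteP[G [TG ndG Goo]] := sigma_finiteT mu.
exists (fun k => [set y | F k (thead y) /\ G k [tuple of behead y]]).
  apply/esym; rewrite -subTset => y _.
  have [i _ Fi] : (\bigcup_i F i) (thead y) by rewrite -TF.
  have [j _ Gj] : (\bigcup_i G i) [tuple of behead y] by rewrite -TG.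
  exists (maxn i j) => //; split.
    by move: Fi; exact/subsetPset/ndF/leq_maxl.
  by move: Gj; exact/subsetPset/ndG/leq_maxr.
move=> k; have [mF Fk] := Foo k; have [mG Gk] := Goo k.
split; first exact: measurable_uncons.
by rewrite lebesgue_consX// lte_mul_pinfty// ge0_fin_numE.
Qed.

HB.instance Definition _ := Measure_isSigmaFinite.Build _ _ _ lebesgue_cons
  lebesgue_cons_sigma_finite.

End Step.

Fixpoint lebesgue_tuple n : {sigma_finite_measure set (n.-tuple mR) -> \bar R} :=
  match n with
  | 0 => \d_ ([tuple] : 0.-tuple mR)
  | m.+1 => lebesgue_cons (lebesgue_tuple m)
  end.

Lemma lebesgue_tuple_box n (A : 'I_n -> set mR) :
  (forall i, measurable (A i)) ->
  lebesgue_tuple n [set y | forall i, A i (tnth y i)] =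
  (\prod_(i < n) lebesgue_measure (A i))%E.
Proof.
elim: n A => [|n IHn] A mA.
  rewrite big_ord0 /= diracE mem_set//= => -[].
  by case.
have mB : measurable [set y : n.-tuple mR | forall i, A (lift ord0 i) (tnth y i)].
  rewrite (_ : [set _ | _] =
    \bigcap_(i in [set: 'I_n]) ((fun y : n.-tuple mR => tnth y i) @^-1` A (lift ord0 i))).
    apply: fin_bigcap_measurable => [|i _]; first exact: finite_finset.
    have := @measurable_tnth _ mR n i measurableT _ (mA (lift ord0 i)).
    by rewrite setTI.
  by apply/seteqP; split => y /= h i => [_|]; exact: h.
rewrite big_ord_recl -IHn// -lebesgue_consX//=; congr lebesgue_cons.
apply/seteqP; split => y /=.
  move=> h; split => [|i]; first exact: h ord0.
  have := h (lift ord0 i); rewrite [y in tnth y (lift _ _)]tuple_eta tnthS.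
  by congr (A _ (tnth _ _)); apply: val_inj.
move=> [h0 h] i; case: (unliftP ord0 i) => [j ->|->//].
rewrite [y in tnth y _]tuple_eta tnthS.
have := h j; congr (A _ (tnth _ _)); exact: val_inj.
Qed.

Definition row_of_tuple n (y : n.-tuple R) : 'rV[R]_n := \row_i tnth y i.

Definition integral_rV n (A : set 'rV[R]_n) (f : 'rV[R]_n -> R) : R :=
  \int[lebesgue_tuple n]_(y in @row_of_tuple n @^-1` A) f (row_of_tuple y).

Definition integral_rV_vec n N (A : set 'rV[R]_n) (f : 'rV[R]_n -> 'rV[R]_N) :
    'rV[R]_N :=
  \row_l integral_rV A (fun x => f x ord0 l).

Definition integral_time N (t0 t1 : R) (f : R -> 'rV[R]_N) : 'rV[R]_N :=
  \row_l \int[lebesgue_measure]_(t in `[t0, t1]) f t ord0 l.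

End LebesgueMeasure.

Section Simplices.
Context {R : realType}.

Definition dotv D (u v : 'rV[R]_D) : R := \sum_i u ord0 i * v ord0 i.

Definition conv_hull D (I : finType) (A : {set I}) (p : I -> 'rV[R]_D) :
    set 'rV[R]_D :=
  [set x | exists l : I -> R, [/\ forall i, i \in A -> 0 <= l i,
     \sum_(i in A) l i = 1 & x = \sum_(i in A) l i *: p i]].

(* A simplex is given by the matrix whose rows are its vertices. *)
Definition simplex m D (P : 'M[R]_(m, D)) : set 'rV[R]_D :=
  conv_hull [set: 'I_m] (fun a => row a P).

Definition unit_simplex m : set 'rV[R]_m :=
  [set s | (forall i, 0 <= s ord0 i) /\ \sum_i s ord0 i <= 1].

Definition edge_mx m D (Q : 'M[R]_(m.+1, D)) : 'M[R]_(m, D) :=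
  \matrix_(i < m) (row (lift ord0 i) Q - row ord0 Q).

(* Integral with respect to the m-dimensional surface measure over the
   m-simplex of R^D with vertices the rows of Q: the simplex is parametrized
   affinely by the unit simplex of R^m and the area element is the square root
   of the Gram determinant. For m = 0 this is evaluation at the vertex. *)
Definition integral_simplex m D N (Q : 'M[R]_(m.+1, D))
    (g : 'rV[R]_D -> 'rV[R]_N) : 'rV[R]_N :=
  let E := edge_mx Q in
  integral_rV_vec (@unit_simplex m)
    (fun s => Num.sqrt (\det (E *m E^T)) *: g (row ord0 Q + s *m E)).

Section FullSimplex.
Variable n : nat.
Implicit Types (P : 'M[R]_(n.+2, n.+1)) (x : 'rV[R]_n.+1) (a : 'I_n.+2).

(* The rows of this square matrix are (1, p_a), p_a being the vertices. Its
   determinant is that of the matrix of the edges p_a - p_0, that is, n.+1!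
   times the signed volume of the simplex. *)
Definition vertex_mx P : 'M[R]_n.+2 := row_mx (const_mx 1 : 'cV[R]_n.+2) P.

(* For a nondegenerate simplex this is the unique row l of weights such that
   \sum_a l_a = 1 and \sum_a l_a p_a = x. *)
Definition barycentric P x : 'rV[R]_n.+2 :=
  row_mx (const_mx 1 : 'cV[R]_1) x *m invmx (vertex_mx P).

Let mul_vertex_mx P (l : 'rV[R]_n.+2) :
  l *m vertex_mx P = row_mx (const_mx (\sum_a l ord0 a) : 'cV[R]_1) (l *m P).
Proof.
rewrite (_ : const_mx _ = l *m (const_mx 1 : 'cV[R]_n.+2)).
  exact: (@mul_mx_row R 1 n.+2 1 n.+1 l (const_mx 1) P).
apply/colP => z; rewrite !mxE; apply: eq_bigr => a _.
by rewrite mxE mulr1 (ord1 z).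
Qed.

Lemma barycentric_affine P (l : 'rV[R]_n.+2) :
  \det (vertex_mx P) != 0 -> \sum_a l ord0 a = 1 -> barycentric P (l *m P) = l.
Proof.
move=> P0 l1; rewrite /barycentric -l1 -mul_vertex_mx.
by rewrite mulmxK// unitmxE unitfE.
Qed.

Lemma barycentricP P x : \det (vertex_mx P) != 0 ->
  \sum_a barycentric P x ord0 a = 1 /\ barycentric P x *m P = x.
Proof.
move=> P0.
have : barycentric P x *m vertex_mx P = row_mx (const_mx 1 : 'cV[R]_1) x.
  by rewrite mulmxKV// unitmxE unitfE.
rewrite mul_vertex_mx => E.
have [/rowP/(_ ord0) + ->] := @eq_row_mx R 1 1 n.+1 _ _ _ _ E.
by rewrite !mxE.
Qed.

(* The facet opposite to the vertex a. *)
Definition facet P a : 'M[R]_(n.+1, n.+1) := row' a P.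

Definition integral_boundary N P (g : 'I_n.+2 -> 'rV[R]_n.+1 -> 'rV[R]_N) :
    'rV[R]_N :=
  \sum_a integral_simplex (facet P a) (g a).

Definition outward_unit_normal P a (nu : 'rV[R]_n.+1) : Prop :=
  [/\ dotv nu nu = 1,
      forall b c, b != a -> c != a -> dotv nu (row b P - row c P) = 0
    & forall b, b != a -> dotv nu (row a P - row b P) < 0].

End FullSimplex.
End Simplices.

(* The space dimension is n.+1, so that a cell has n.+2 vertices and facets;
   the facet number a of a cell is the one opposite to its vertex number a. *)
Record mesh_data (R : realType) (n : nat) := MeshData {
  vertex : finType;
  cell : finType;
  corner : cell -> 'I_n.+2 -> vertex;
  position : vertex -> R -> 'rV[R]_n.+1;
  velocity : vertex -> 'rV[R]_n.+1
}.

Section MovingMesh.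
Context {R : realType} {n : nat}.
Variable T : mesh_data R n.
Implicit Types (i j : cell T) (a b : 'I_n.+2) (t : R) (x : 'rV[R]_n.+1).

Definition cell_mx i t : 'M[R]_(n.+2, n.+1) :=
  \matrix_a position (corner i a) t.

Definition cell_set i t : set 'rV[R]_n.+1 := simplex (cell_mx i t).

Definition cell_vertices i : {set vertex T} := [set corner i a | a : 'I_n.+2].

Definition facet_vertices i a : {set vertex T} :=
  [set corner i b | b in [set~ a]].

Definition facet_set i a t : set 'rV[R]_n.+1 := simplex (facet (cell_mx i t) a).

Definition neighbour i a j : bool :=
  (j != i) && [exists b, facet_vertices j b == facet_vertices i a].

Record moving_simplicial_mesh (t0 t1 : R) (Omega : R -> set 'rV[R]_n.+1) :
    Prop := MovingSimplicialMesh {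
  mesh_motion : forall (v : vertex T) t, t0 <= t <= t1 ->
    position v t = position v t0 + (t - t0) *: velocity v;
  mesh_oriented : forall i t, t0 <= t <= t1 -> 0 < \det (vertex_mx (cell_mx i t));
  mesh_distinct : injective cell_vertices;
  mesh_conforming : forall i j t, t0 <= t <= t1 ->
    cell_set i t `&` cell_set j t =
    conv_hull (cell_vertices i :&: cell_vertices j) (fun v => position v t);
  (* the cells are closed whereas Omega t may be given as an open set *)
  mesh_covering : forall t, t0 <= t <= t1 ->
    \bigcup_(i in [set: cell T]) cell_set i t = closure (Omega t)
}.

Definition mesh_velocity i x t : 'rV[R]_n.+1 :=
  barycentric (cell_mx i t) x *m \matrix_a velocity (corner i a).

(* The affine map xi |-> x(xi, t) from the reference simplex, whose vertices
   are the rows of Khat, to the cell, and its inverse. *)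
Definition to_cell (Khat : 'M[R]_(n.+2, n.+1)) i (xi : 'rV[R]_n.+1) t :
    'rV[R]_n.+1 :=
  barycentric Khat xi *m cell_mx i t.

Definition to_ref (Khat : 'M[R]_(n.+2, n.+1)) i x t : 'rV[R]_n.+1 :=
  barycentric (cell_mx i t) x *m Khat.

Lemma to_refK Khat i xi t :
  \det (vertex_mx Khat) != 0 -> \det (vertex_mx (cell_mx i t)) != 0 ->
  to_ref Khat i (to_cell Khat i xi t) t = xi.
Proof.
move=> K0 P0; have [l1 lK] := barycentricP xi K0.
by rewrite /to_ref barycentric_affine.
Qed.

End MovingMesh.

(* The notations of this file clash with those of the analysis library. *)
Import -(notations) mpoly.

Section DiscontinuousGalerkin.
Context {R : realType} {n N M : nat}.

Definition poly_eval (p : mpoly n.+1 R) (x : 'rV[R]_n.+1) : R :=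
  meval (fun i => x ord0 i) p.

Record orthonormal_basis (Khat : 'M[R]_(n.+2, n.+1)) (k : nat)
    (phihat : 'I_M.+1 -> mpoly n.+1 R) : Prop := OrthonormalBasis {
  basis_degree : forall m, (msize (phihat m) <= k.+1)%N;
  basis_coords : forall p, (msize p <= k.+1)%N ->
    exists! c : 'rV[R]_M.+1, p = \sum_m c ord0 m *: phihat m;
  basis_orthonormal : forall m l,
    integral_rV (simplex Khat)
      (fun xi => poly_eval (phihat m) xi * poly_eval (phihat l) xi) =
    (m == l)%:R;
  basis_constant : exists2 c : R, c != 0 & phihat ord0 = mpolyC n.+1 c
}.

Definition gradient (f : 'rV[R]_n.+1 -> R) (x : 'rV[R]_n.+1) : 'rV[R]_n.+1 :=
  \row_l 'D_(delta_mx ord0 l) f x.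

(* F i x t u is the i-th component F_i(x, t, u) of the flux. *)
Definition flux :=
  'I_n.+1 -> 'rV[R]_n.+1 -> R -> 'rV[R]_N -> 'rV[R]_N.

(* H x t u^- u^+ w nu *)
Definition numerical_flux :=
  'rV[R]_n.+1 -> R -> 'rV[R]_N -> 'rV[R]_N -> 'rV[R]_n.+1 -> 'rV[R]_n.+1 ->
  'rV[R]_N.

(* The contraction G . v of the ALE flux G = F - u (x) w with a vector v. *)
Definition ale_flux (F : flux) (x : 'rV[R]_n.+1) (t : R) (u : 'rV[R]_N)
    (w v : 'rV[R]_n.+1) : 'rV[R]_N :=
  \sum_i v ord0 i *: (F i x t u - w ord0 i *: u).

Definition consistent (F : flux) (H : numerical_flux) : Prop :=
  forall x t u w nu, dotv nu nu = 1 -> H x t u u w nu = ale_flux F x t u w nu.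

Definition antisymmetric_flux (H : numerical_flux) : Prop :=
  forall x t um up w nu, dotv nu nu = 1 ->
    H x t um up w nu = - H x t up um w (- nu).

Variable T : mesh_data R n.

Definition basis_on (Khat : 'M[R]_(n.+2, n.+1))
    (phihat : 'I_M.+1 -> mpoly n.+1 R)
    (i : cell T) (m : 'I_M.+1) (x : 'rV[R]_n.+1) (t : R) : R :=
  poly_eval (phihat m) (to_ref Khat i x t).

Definition dg_value (Khat : 'M[R]_(n.+2, n.+1))
    (phihat : 'I_M.+1 -> mpoly n.+1 R)
    (U : cell T -> 'I_M.+1 -> R -> 'rV[R]_N)
    (i : cell T) (x : 'rV[R]_n.+1) (t : R) : 'rV[R]_N :=
  \sum_m basis_on Khat phihat i m x t *: U i m t.

(* The outside value on the facet a of the cell i: the value from the cell on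
   the other side if there is one, and otherwise the value ub prescribed by
   the scheme on the domain boundary. *)
Definition outside_value (u : cell T -> 'rV[R]_n.+1 -> R -> 'rV[R]_N)
    (ub : cell T -> 'I_n.+2 -> 'rV[R]_n.+1 -> R -> 'rV[R]_N)
    (i : cell T) (a : 'I_n.+2) (x : 'rV[R]_n.+1) (t : R) : 'rV[R]_N :=
  if [pick j | neighbour i a j] is Some j then u j x t else ub i a x t.

End DiscontinuousGalerkin.

Arguments flux : clear implicits.
Arguments numerical_flux : clear implicits.

(* Main.v *)
Require Import Defs.
From HB Require Import structures.
From mathcomp Require Import all_boot all_order all_algebra.
From mathcomp Require Import all_classical all_reals all_analysis.
From mathcomp Require mpoly.
Set Implicit Arguments.
Unset Strict Implicit.
Unset Printing Implicit Defensive.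
Import Order.TTheory GRing.Theory Num.Theory.
Import numFieldNormedType.Exports.
Local Open Scope classical_set_scope.
Local Open Scope ring_scope.

(** Balance in a cell. The basis function number 0 is a nonzero constant c, so
    its gradient vanishes, the volume term of the scheme drops out, and c can be
    pulled out of the three remaining integrals and cancelled. Nothing is known
    about the integrability of the fluxes H and F along the discrete solution.
    The cancellation holds all the same because the real-valued Lebesgue
    integral commutes with multiplication by a constant for every integrand,
    measurable or not ([RintegralZl_any]). Summing over the cells gives the
    second claim.

    Opposite fluxes. Let distinct cells i and j share a facet with vertex set S,
    opposite to the vertex p of i and to the vertex q of j. The cells have no
    other common vertex, since distinct cells have distinct vertex sets, so by
    conformity they meet exactly in the convex hull of S. The heart of the
    matter is that p and q lie on opposite sides of the facet. Write p in
    barycentric coordinates m with respect to j. If m(q) were nonnegative, then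
    moving the negative terms to the other side would give a Radon point
        p + sum of m^-(v) v  =  sum of m^+(v) v,    both sides normalized,
    where the left sum runs over S only; this point would belong to both cells
    but have a nonzero coordinate on p, hence lie outside the hull of S
    ([apex_weight_lt0]). So m(q) < 0, and therefore the opposite of an outward
    normal of i is an outward normal of j ([outward_normal_shared]); outward
    unit normals being unique, nu_j = - nu_i.

    This also shows that a facet belongs to at most two cells: with a third one,
    two of the three normals would be equal and opposite ([neighbour_uniq]).
    Hence the outside value seen from i is the inside value of j and conversely.
    The mesh velocity on the facet only depends on the velocities of the
    vertices in S ([mesh_velocity_facet]), so it is the same from both sides,
    and the antisymmetry of H concludes. *)

(** * Homogeneity of the integral without measurability *)

Section Homogeneity.
Context d (T : measurableType d) (R : realType).
Variable mu : {measure set T -> \bar R}.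
Implicit Types (D : set T) (c : R).
Import HBNNSimple.

(** Scaling by c > 0 permutes the nonnegative simple functions, and carries
    those below f to those below c f; the integral of f is the supremum of
    their integrals, whether or not f and D are measurable. *)
Lemma ge0_integralZl_any D (f : T -> \bar R) c : 0 < c ->
  (forall x, 0 <= f x)%E ->
  (\int[mu]_(x in D) (c%:E * f x) = c%:E * \int[mu]_(x in D) f x)%E.
Proof.
have le_scale (g : T -> \bar R) k : 0 < k -> (forall x, 0 <= g x)%E ->
    (k%:E * \int[mu]_(x in D) g x <= \int[mu]_(x in D) (k%:E * g x))%E.
  move=> k0 g0; rewrite muleC -lee_pdivlMr// !ge0_integralE//; last first.
    by move=> x _; rewrite mule_ge0// lee_fin ltW.
  apply: ge_ereal_sup => _ [h/= hg] <-.
  rewrite lee_pdivlMr// muleC -sintegralrM.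
  apply: ereal_sup_ubound; exists (scale_nnsfun h (ltW k0)) => //= x.
  rewrite erestrict_scale EFinM lee_pmul2l//; exact: hg.
move=> c0 f0; apply/le_anti; rewrite le_scale// andbT.
(* The other inequality is le_scale for the function c f and the factor 1/c. *)
rewrite muleC -lee_pdivrMr// muleC.
have -> : (\int[mu]_(x in D) f x = \int[mu]_(x in D) (c^-1%:E * (c%:E * f x)))%E.
  by apply: eq_integral => x _; rewrite muleA -EFinM mulVf ?gt_eqF// mul1e.
by apply: le_scale; rewrite ?invr_gt0// => x; rewrite mule_ge0// lee_fin ltW.
Qed.

(** When x and y are the same infinity both differences are infinite, and [fine]
    sends them to 0. *)
Lemma fineBC (x y : \bar R) : fine (x - y)%E = - fine (y - x)%E.
Proof. by case: x y => [x||] [y||] //=; rewrite ?oppr0// opprB. Qed.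

Lemma fine_scaleB (k : R) (x y : \bar R) : 0 < k ->
  fine (k%:E * x - k%:E * y)%E = k * fine (x - y)%E.
Proof.
move=> k0; have k0' : (0 < k%:E)%E by rewrite lte_fin.
case: x y => [x||] [y||] //=;
  by rewrite ?(gt0_muley k0') ?(gt0_muleNy k0') /= ?mulr0// mulrBr.
Qed.

(** The positive and negative parts may both have an infinite integral; the
    integral of f and that of c f are then both 0, so the rule persists. *)
Lemma RintegralZl_any D (f : T -> R) c :
  \int[mu]_(x in D) (c * f x) = c * \int[mu]_(x in D) f x.
Proof.
have pos k : 0 < k -> \int[mu]_(x in D) (k * f x) = k * \int[mu]_(x in D) f x.
  move=> k0; rewrite /Rintegral.
  under eq_integral do rewrite EFinM.
  rewrite integralE [in RHS]integralE (ge0_funeposM _ (ltW k0)).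
  rewrite (ge0_funenegM _ (ltW k0)) !ge0_integralZl_any//.
  exact: fine_scaleB.
have opp g : \int[mu]_(x in D) (- g x) = - \int[mu]_(x in D) g x.
  rewrite /Rintegral; under eq_integral do rewrite EFinN.
  by rewrite integralE [in RHS]integralE funeposN funenegN fineBC.
have [k0|k0|->] := ltgtP c 0; last 2 first.
- exact: pos.
- rewrite mul0r; under eq_Rintegral do rewrite mul0r.
  by rewrite /Rintegral integral0.
rewrite -[c]opprK mulNr -pos ?oppr_gt0// -opp.
by apply: eq_Rintegral => x _; rewrite mulNr.
Qed.
End Homogeneity.

(** * Constants in the integrals of the scheme *)

Section VectorIntegrals.
Context {R : realType}.

Lemma integral_rV_vecZ n N (A : set 'rV[R]_n) (f : 'rV[R]_n -> 'rV[R]_N) c :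
  integral_rV_vec A (fun x => c *: f x) = c *: integral_rV_vec A f.
Proof.
apply/rowP => l; rewrite !mxE /integral_rV -RintegralZl_any.
by apply: eq_Rintegral => y _; rewrite mxE.
Qed.

Lemma integral_timeZ N (t0 t1 : R) (f : R -> 'rV[R]_N) c :
  integral_time t0 t1 (fun t => c *: f t) = c *: integral_time t0 t1 f.
Proof.
apply/rowP => l; rewrite !mxE -RintegralZl_any.
by apply: eq_Rintegral => y _; rewrite mxE.
Qed.

Lemma integral_boundaryZ n N (P : 'M[R]_(n.+2, n.+1))
    (g : 'I_n.+2 -> 'rV[R]_n.+1 -> 'rV[R]_N) c :
  integral_boundary P (fun a x => c *: g a x) = c *: integral_boundary P g.
Proof.
rewrite /integral_boundary scaler_sumr; apply: eq_bigr => a _.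
rewrite /integral_simplex -integral_rV_vecZ; congr integral_rV_vec.
by apply/funext => s; rewrite !scalerA mulrC.
Qed.

Lemma integral_rV_vec0 n N (A : set 'rV[R]_n) :
  integral_rV_vec A (fun=> 0 : 'rV[R]_N) = 0.
Proof. by have := integral_rV_vecZ A (fun=> 0 : 'rV[R]_N) 0; rewrite !scale0r. Qed.

Lemma integral_time0 N (t0 t1 : R) : integral_time t0 t1 (fun=> 0 : 'rV[R]_N) = 0.
Proof. by have := integral_timeZ t0 t1 (fun=> 0 : 'rV[R]_N) 0; rewrite !scale0r. Qed.

End VectorIntegrals.

Section ConstantBasisFunction.
Context {R : realType} {n N M : nat}.

Lemma ale_flux_gradient_cst (F : flux R n N) x t u w (c : R) :
  ale_flux F x t u w (gradient (fun=> c) x) = 0.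
Proof.
by apply: big1 => i _; rewrite mxE derive_cst scale0r.
Qed.

Lemma basis_on_cst (T : mesh_data R n) Khat (phihat : 'I_M.+1 -> mpoly.mpoly n.+1 R)
    (m : 'I_M.+1) c (i : cell T) x t :
  phihat m = mpoly.mpolyC n.+1 c -> basis_on Khat phihat i m x t = c.
Proof. by move=> phim; rewrite /basis_on /poly_eval phim mpoly.mevalC. Qed.

End ConstantBasisFunction.

(** * Outward unit normals of a simplex *)

Section Normals.
Context {R : realType}.

Lemma dotvC D (u v : 'rV[R]_D) : dotv u v = dotv v u.
Proof. by apply: eq_bigr => i _; rewrite mulrC. Qed.

Lemma dotvDr D (u v w : 'rV[R]_D) : dotv u (v + w) = dotv u v + dotv u w.
Proof.
by rewrite -big_split; apply: eq_bigr => i _; rewrite mxE mulrDr.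
Qed.

Lemma dotvZr D (u v : 'rV[R]_D) c : dotv u (c *: v) = c * dotv u v.
Proof.
by rewrite /dotv mulr_sumr; apply: eq_bigr => i _; rewrite mxE mulrCA.
Qed.

Lemma dotvNr D (u v : 'rV[R]_D) : dotv u (- v) = - dotv u v.
Proof. by rewrite -scaleN1r dotvZr mulN1r. Qed.

Lemma dotvNl D (u v : 'rV[R]_D) : dotv (- u) v = - dotv u v.
Proof. by rewrite dotvC dotvNr dotvC. Qed.

Lemma dotv_sumr D (I : finType) (A : pred I) (u : 'rV[R]_D) (F : I -> 'rV[R]_D) :
  dotv u (\sum_(v | A v) F v) = \sum_(v | A v) dotv u (F v).
Proof.
apply: (big_morph (dotv u)) => [v w|]; first exact: dotvDr.
by have := dotvZr u 0 0; rewrite !scale0r mul0r.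
Qed.

Lemma dotv_eq0 D (u : 'rV[R]_D) : dotv u u = 0 -> u = 0.
Proof.
move=> /eqP; rewrite psumr_eq0 => [/allP u0|i _]; last by rewrite -expr2 sqr_ge0.
apply/rowP => i; rewrite mxE.
have := u0 i (mem_index_enum i).
by rewrite /= -expr2 sqrf_eq0 => /eqP.
Qed.

(** With affine coordinates l of p_b + z, the hypothesis says that z . p_c does
    not depend on c, so z . (p_b + z) = z . p_b and thus z . z = 0. *)
Lemma orthogonal_to_edges n (P : 'M[R]_(n.+2, n.+1)) b (z : 'rV[R]_n.+1) :
  \det (vertex_mx P) != 0 ->
  (forall c, dotv z (row c P) = dotv z (row b P)) -> z = 0.
Proof.
move=> P0 zP; have [l1 lK] := barycentricP (row b P + z) P0.
apply: dotv_eq0; apply: (addrI (dotv z (row b P))).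
rewrite -dotvDr -lK mulmx_sum_row addr0.
rewrite dotv_sumr.
under eq_bigr do rewrite dotvZr zP.
by rewrite -mulr_suml l1 mul1r.
Qed.

(** Two normals nu and nu' are both orthogonal to the facet, so the combination
    that also kills one edge to the opposite vertex is 0: they are proportional.
    Being of unit length and on the same side, they are equal. *)
Lemma outward_unit_normal_uniq n (P : 'M[R]_(n.+2, n.+1)) a nu nu' :
  \det (vertex_mx P) != 0 ->
  outward_unit_normal P a nu -> outward_unit_normal P a nu' -> nu = nu'.
Proof.
move=> P0 [nu1 nuF nu_out] [nu1' nuF' nu_out'].
pose b := lift a ord0; have ba : b != a by rewrite eq_sym neq_lift.
pose s := dotv nu (row a P - row b P); pose s' := dotv nu' (row a P - row b P).
have s0 : s < 0 := nu_out b ba.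
have s0' : s' < 0 := nu_out' b ba.
have E : s' *: nu = s *: nu'.
  apply/eqP; rewrite -subr_eq0; apply/eqP.
  apply: (@orthogonal_to_edges _ P b) => // c; apply/eqP; rewrite -subr_eq0 -dotvNr.
  rewrite -dotvDr dotvC dotvDr dotvNr !dotvZr !(dotvC (_ - _)).
  have [->|ca] := eqVneq c a; first by rewrite -/s -/s' mulrC subrr.
  by rewrite nuF ?nuF'// !mulr0 subrr.
have : s' ^+ 2 = s ^+ 2.
  have := congr1 (fun v => dotv v v) E.
  by rewrite /= !dotvZr ![dotv (_ *: _) _]dotvC !dotvZr nu1 nu1' !mulr1.
move=> /eqP; rewrite eqf_sqr => /predU1P[ss|/eqP ss]; last first.
  by move: s0'; rewrite ss oppr_lt0 ltNge (ltW s0).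
move: E; rewrite ss; apply: scalerI; exact: ltr0_neq0.
Qed.

End Normals.

(** * Weights on the vertices of a cell *)

Section MeshGeometry.
Context {R : realType} {n : nat} (T : mesh_data R n) (t0 t1 : R).
Context (Omega : R -> set 'rV[R]_n.+1).
Context (meshT : moving_simplicial_mesh T t0 t1 Omega).
Context (t : R) (tP : t0 <= t <= t1).
Implicit Types (i j : cell T) (a b c : 'I_n.+2) (m : vertex T -> R).
Local Notation p v := (position v t).

Let det_neq0 i : \det (vertex_mx (cell_mx i t)) != 0.
Proof. by rewrite gt_eqF// (mesh_oriented meshT). Qed.

Lemma corner_inj i : injective (corner i).
Proof.
move=> c d cd; apply: contraTeq (det_neq0 i) => cNd; apply/negPn/eqP.
apply: (determinant_alternate cNd) => e; rewrite !mxE.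
by case: splitP => k _; rewrite !mxE// cd.
Qed.

Lemma facet_verticesP i a v :
  reflect (exists2 c, c != a & v = corner i c) (v \in facet_vertices i a).
Proof.
apply: (iffP imsetP) => -[c ca ->]; exists c => //.
  by move: ca; rewrite inE => /eqP.
by rewrite inE; apply/eqP.
Qed.

Lemma corner_notin_facet i a : corner i a \notin facet_vertices i a.
Proof.
by apply/facet_verticesP => -[b + /corner_inj ab]; rewrite ab eqxx.
Qed.

Lemma cell_verticesU1 i a : cell_vertices i = corner i a |: facet_vertices i a.
Proof.
apply/setP => v; rewrite !inE; apply/imsetP/predU1P => [[c _ ->]|].
  have [->|ca] := eqVneq c a; [by left|right].
  by apply/facet_verticesP; exists c.
move=> [->|/facet_verticesP[c _ ->]]; [by exists a|by exists c].
Qed.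

Lemma sum_cell_vertices (V : nmodType) (F : vertex T -> V) i :
  \sum_(v in cell_vertices i) F v = \sum_c F (corner i c).
Proof. by rewrite big_imset//= => c d _ _; exact: corner_inj. Qed.

Lemma sum_cell_facet (V : nmodType) (F : vertex T -> V) i a :
  \sum_(v in cell_vertices i) F v =
  F (corner i a) + \sum_(v in facet_vertices i a) F v.
Proof. by rewrite (cell_verticesU1 i a) big_setU1 ?corner_notin_facet. Qed.

Lemma sum_facet_vertices (V : zmodType) (F : vertex T -> V) i a :
  \sum_(v in facet_vertices i a) F v = \sum_(e < n.+1) F (corner i (lift a e)).
Proof.
apply: (addrI (F (corner i a))); rewrite -sum_cell_facet sum_cell_vertices.
by rewrite (bigD1_ord a).
Qed.

(** Weights are functions on the vertices of the mesh rather than on corner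
    numbers, so that the same function can serve two cells sharing vertices. *)
Lemma mul_cell_mx i m (q : vertex T -> 'rV[R]_n.+1) :
  (\row_c m (corner i c)) *m (\matrix_c q (corner i c)) =
  \sum_(v in cell_vertices i) m v *: q v.
Proof.
rewrite sum_cell_vertices mulmx_sum_row.
by apply: eq_bigr => c _; rewrite mxE rowK.
Qed.

Lemma barycentric_weights i m x :
  \sum_(v in cell_vertices i) m v = 1 ->
  \sum_(v in cell_vertices i) m v *: p v = x ->
  barycentric (cell_mx i t) x = \row_c m (corner i c).
Proof.
move=> m1 <-; rewrite -mul_cell_mx barycentric_affine//.
by rewrite -m1 sum_cell_vertices; apply: eq_bigr => c _; rewrite mxE.
Qed.

Lemma weights_uniq i m m' :
  \sum_(v in cell_vertices i) m v = 1 -> \sum_(v in cell_vertices i) m' v = 1 ->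
  \sum_(v in cell_vertices i) m v *: p v =
    \sum_(v in cell_vertices i) m' v *: p v ->
  forall c, m (corner i c) = m' (corner i c).
Proof.
move=> m1 m1' mm' c; have := barycentric_weights m1' (erefl _).
by rewrite -mm' (barycentric_weights m1 (erefl _)) => /rowP/(_ c); rewrite !mxE.
Qed.

Lemma weights_exist i x : exists m,
  \sum_(v in cell_vertices i) m v = 1 /\
  \sum_(v in cell_vertices i) m v *: p v = x.
Proof.
have [l1 lK] := barycentricP x (det_neq0 i).
pose m v := \sum_(c | corner i c == v) barycentric (cell_mx i t) x ord0 c.
have mE c : m (corner i c) = barycentric (cell_mx i t) x ord0 c.
  by apply: big_pred1 => d; rewrite /= (inj_eq (@corner_inj i)).
exists m; split.
  by rewrite sum_cell_vertices -[RHS]l1; apply: eq_bigr => c _.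
rewrite -mul_cell_mx -[RHS]lK; congr (_ *m _).
by apply/rowP => c; rewrite mxE mE.
Qed.

Lemma cell_set_conv i m :
  (forall v, 0 <= m v) -> \sum_(v in cell_vertices i) m v = 1 ->
  cell_set i t (\sum_(v in cell_vertices i) m v *: p v).
Proof.
move=> m0 m1; exists (fun c => m (corner i c)); split=> //.
  by rewrite -m1 sum_cell_vertices; apply: eq_bigl => c; rewrite inE.
rewrite sum_cell_vertices; apply: eq_big => c; rewrite ?inE// => _.
by rewrite rowK.
Qed.

Lemma facet_set_weights i a x : facet_set i a t x -> exists m,
  \sum_(v in facet_vertices i a) m v = 1 /\
  \sum_(v in facet_vertices i a) m v *: p v = x.
Proof.
move=> [l [_ l1 ->]].
pose m v := \sum_(e < n.+1 | corner i (lift a e) == v) l e.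
have mE (e : 'I_n.+1) : m (corner i (lift a e)) = l e.
  by apply: big_pred1 => d; rewrite /= (inj_eq (@corner_inj i)) (inj_eq lift_inj).
exists m; rewrite !sum_facet_vertices; split.
  by rewrite -l1; apply: eq_big => c; rewrite ?inE.
by apply: eq_big => c; rewrite ?inE// => _; rewrite mE /facet row_rowsub rowK.
Qed.

Lemma sum_facet_ext (V : lmodType R) (q : vertex T -> V) i a m :
  \sum_(v in cell_vertices i) (if v \in facet_vertices i a then m v else 0) *: q v =
  \sum_(v in facet_vertices i a) m v *: q v.
Proof.
rewrite (sum_cell_facet _ _ a) (negPf (corner_notin_facet i a)) scale0r add0r.
by apply: eq_bigr => v ->.
Qed.

Lemma sum_facet_ext1 i a m :
  \sum_(v in cell_vertices i) (if v \in facet_vertices i a then m v else 0) =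
  \sum_(v in facet_vertices i a) m v.
Proof.
rewrite (sum_cell_facet _ _ a) (negPf (corner_notin_facet i a)) add0r.
by apply: eq_bigr => v ->.
Qed.

(** On a facet the barycentric coordinate of the opposite vertex is 0, so its
    velocity does not enter. *)
Lemma mesh_velocity_facet i a m x :
  \sum_(v in facet_vertices i a) m v = 1 ->
  \sum_(v in facet_vertices i a) m v *: p v = x ->
  mesh_velocity i x t = \sum_(v in facet_vertices i a) m v *: velocity v.
Proof.
rewrite -sum_facet_ext1 -!sum_facet_ext => m1 mx.
by rewrite /mesh_velocity (barycentric_weights m1 mx) -mul_cell_mx.
Qed.

(** * Two cells sharing a facet *)

Section SharedFacet.
Context (i j : cell T) (a b : 'I_n.+2).
Context (ij : i != j) (Fij : facet_vertices i a = facet_vertices j b).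

Lemma mesh_velocity_shared x : facet_set i a t x ->
  mesh_velocity i x t = mesh_velocity j x t.
Proof.
move=> /facet_set_weights[m [m1 mx]]; rewrite (mesh_velocity_facet m1 mx).
by move: m1 mx; rewrite Fij => m1 mx; rewrite (mesh_velocity_facet m1 mx).
Qed.

(** A further common vertex would have to be the apex of both cells, which would
    then have the same vertices. *)
Lemma common_vertices :
  cell_vertices i :&: cell_vertices j = facet_vertices i a.
Proof.
rewrite (cell_verticesU1 i a) (cell_verticesU1 j b) -Fij -finset.setUIl.
apply/finset.setUidPr/fintype.subsetP => v; rewrite !inE => /andP[/eqP-> /eqP ab].
move: ij => /eqP[]; apply: (mesh_distinct meshT).
by rewrite (cell_verticesU1 i a) (cell_verticesU1 j b) -Fij ab.
Qed.

(** The vertex of cell i opposite to the shared facet lies strictly on the other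
    side of this facet from cell j. Otherwise the Radon point y below belongs to
    both cells, hence to the facet, although its coordinate on that vertex,
    1/s, is nonzero. *)
Lemma apex_weight_lt0 m :
  \sum_(v in cell_vertices j) m v = 1 ->
  \sum_(v in cell_vertices j) m v *: p v = p (corner i a) ->
  m (corner j b) < 0.
Proof.
move=> m1 mp; rewrite ltNge; apply/negP => mb.
pose neg v := Num.max (- m v) 0; pose pos v := m v + neg v.
have neg0 v : 0 <= neg v by rewrite le_max lexx orbT.
have pos0 v : 0 <= pos v by rewrite /pos addr_maxr subrr addr0 le_max lexx.
have negb : neg (corner j b) = 0 by apply/max_idPr; rewrite oppr_le0.
pose s := 1 + \sum_(v in facet_vertices i a) neg v.
have s0 : 0 < s by rewrite ltr_wpDr// sumr_ge0.
have sV : s^-1 * s = 1 by rewrite mulVf// gt_eqF.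
pose y := s^-1 *: (p (corner i a) + \sum_(v in facet_vertices i a) neg v *: p v).
pose wi v := s^-1 * (if v == corner i a then 1 else neg v).
have wiF v : v \in facet_vertices i a -> wi v = s^-1 * neg v.
  move=> vF; rewrite /wi ifN//; apply: contraTneq vF => ->.
  exact: corner_notin_facet.
have wi1 : \sum_(v in cell_vertices i) wi v = 1.
  rewrite (sum_cell_facet _ _ a) (eq_bigr _ wiF) -mulr_sumr {1}/wi eqxx.
  by rewrite -mulrDr.
have wiy : \sum_(v in cell_vertices i) wi v *: p v = y.
  rewrite (sum_cell_facet _ _ a) {1}/wi eqxx mulr1 /y scalerDr scaler_sumr.
  by congr +%R; apply: eq_bigr => v vF; rewrite wiF// scalerA.
have yi : cell_set i t y.
  rewrite -wiy; apply: cell_set_conv => // v.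
  by rewrite /wi mulr_ge0 ?invr_ge0 ?(ltW s0)//; case: ifP.
have yj : cell_set j t y.
  have <- : \sum_(v in cell_vertices j) (s^-1 * pos v) *: p v = y.
    under eq_bigr do rewrite -scalerA scalerDl.
    rewrite -scaler_sumr big_split /= mp (sum_cell_facet _ _ b) negb scale0r.
    by rewrite add0r -Fij.
  apply: cell_set_conv => [v|]; first by rewrite mulr_ge0// invr_ge0 ltW.
  rewrite -mulr_sumr big_split /= m1 (sum_cell_facet _ _ b) negb add0r -Fij.
  exact: sV.
have : (cell_set i t `&` cell_set j t) y by [].
rewrite (mesh_conforming meshT)// common_vertices => -[l [_ l1 ly]].
have := @weights_uniq i wi (fun v => if v \in facet_vertices i a then l v else 0).
rewrite sum_facet_ext1 sum_facet_ext wiy => /(_ wi1 l1 ly a).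
rewrite /wi eqxx (negPf (corner_notin_facet i a)) mulr1 => /eqP.
by rewrite invr_eq0 gt_eqF.
Qed.

(** Let p and q be the vertices of i and j opposite to the facet, and v one of
    its vertices. The weights m of p in cell j give
    nu . (p - v) = m(q) nu . (q - v), where m(q) < 0. *)
Lemma outward_normal_shared nu :
  outward_unit_normal (cell_mx i t) a nu ->
  outward_unit_normal (cell_mx j t) b (- nu).
Proof.
move=> [nu1 nuF nu_out].
have nuFv v w : v \in facet_vertices i a -> w \in facet_vertices i a ->
    dotv nu (p v - p w) = 0.
  move=> /facet_verticesP[c ca ->] /facet_verticesP[d da ->].
  by have := nuF _ _ ca da; rewrite !rowK.
have nu_outv v : v \in facet_vertices i a -> dotv nu (p (corner i a) - p v) < 0.
  by move=> /facet_verticesP[c /nu_out + ->]; rewrite !rowK.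
have jF c : c != b -> corner j c \in facet_vertices i a.
  by move=> cb; rewrite Fij; apply/facet_verticesP; exists c.
split; first by rewrite dotvNl dotvNr opprK.
  by move=> c d cb db; rewrite dotvNl !rowK nuFv ?oppr0 ?jF.
move=> c /jF cF; rewrite dotvNl oppr_lt0 !rowK.
have [m [m1 mp]] := weights_exist j (p (corner i a)).
have := nu_outv _ cF.
have -> : p (corner i a) - p (corner j c) =
    \sum_(v in cell_vertices j) m v *: (p v - p (corner j c)).
  under eq_bigr do rewrite scalerBr.
  by rewrite sumrB mp -scaler_suml m1 scale1r.
rewrite dotv_sumr (sum_cell_facet _ _ b) -Fij dotvZr [X in _ + X]big1.
  by rewrite addr0 nmulr_rlt0// apex_weight_lt0.
by move=> v vF; rewrite dotvZr nuFv// mulr0.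
Qed.

Lemma normal_shared nui nuj :
  outward_unit_normal (cell_mx i t) a nui ->
  outward_unit_normal (cell_mx j t) b nuj -> nuj = - nui.
Proof.
move=> nuiP nujP.
exact: outward_unit_normal_uniq (det_neq0 j) nujP (outward_normal_shared nuiP).
Qed.

End SharedFacet.

(** If j and j' were distinct, the normals of the three cells on the common facet
    would be pairwise opposite, so each would be its own opposite. *)
Lemma neighbour_uniq i j j' a b b' nui nuj nuj' : i != j -> i != j' ->
  facet_vertices i a = facet_vertices j b ->
  facet_vertices i a = facet_vertices j' b' ->
  outward_unit_normal (cell_mx i t) a nui ->
  outward_unit_normal (cell_mx j t) b nuj ->
  outward_unit_normal (cell_mx j' t) b' nuj' -> j = j'.
Proof.
move=> ij ij' Fj Fj' nuiP nujP nujP'; apply: contraTeq isT => jj'.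
have nj := normal_shared ij Fj nuiP nujP.
have nj' := normal_shared ij' Fj' nuiP nujP'.
have F : facet_vertices j b = facet_vertices j' b' by rewrite -Fj.
have := normal_shared jj' F nujP nujP'; rewrite nj' -nj => nuN.
have [nu1 _ _] := nujP.
have : dotv nuj nuj = - dotv nuj nuj by rewrite -dotvNr -nuN.
by rewrite nu1 => /eqP; rewrite -subr_eq0 opprK -(natrD _ 1 1) pnatr_eq0.
Qed.

End MeshGeometry.

(** * Conservation *)

Theorem mainTheorem2 (R : realType) (n N k M : nat) (t0 t1 : R) (t01 : t0 < t1)
  (Omega : R -> set 'rV[R]_n.+1) (T : mesh_data R n)
  (meshT : moving_simplicial_mesh T t0 t1 Omega)
  (nu : cell T -> 'I_n.+2 -> R -> 'rV[R]_n.+1)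
  (nuP : forall i a t, t0 <= t <= t1 ->
    outward_unit_normal (cell_mx i t) a (nu i a t))
  (Khat : 'M[R]_(n.+2, n.+1)) (Khat0 : \det (vertex_mx Khat) != 0)
  (phihat : 'I_M.+1 -> mpoly.mpoly n.+1 R)
  (phihatP : orthonormal_basis Khat k phihat)
  (F : flux R n N) (H : numerical_flux R n N)
  (H_consistent : consistent F H) (H_antisymmetric : antisymmetric_flux H)
  (U : cell T -> 'I_M.+1 -> R -> 'rV[R]_N)
  (ub : cell T -> 'I_n.+2 -> 'rV[R]_n.+1 -> R -> 'rV[R]_N) :
  let phi := basis_on Khat phihat in
  let u := dg_value Khat phihat U in
  let w := mesh_velocity (T := T) in
  let HK i a x t v :=
    H x t (u i x t) (outside_value u ub i a x t) (w i x t) v in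
  (forall i m,
    integral_rV_vec (cell_set i t1) (fun x => phi i m x t1 *: u i x t1) -
    integral_rV_vec (cell_set i t0) (fun x => phi i m x t0 *: u i x t0) =
    integral_time t0 t1 (fun t => integral_rV_vec (cell_set i t) (fun x =>
      ale_flux F x t (u i x t) (w i x t) (gradient (fun y => phi i m y t) x))) -
    integral_time t0 t1 (fun t => integral_boundary (cell_mx i t) (fun a x =>
      phi i m x t *: HK i a x t (nu i a t)))) ->
  [/\ forall i,
        integral_rV_vec (cell_set i t1) (fun x => u i x t1) -
        integral_rV_vec (cell_set i t0) (fun x => u i x t0) =
        - integral_time t0 t1 (fun t => integral_boundary (cell_mx i t)
            (fun a x => HK i a x t (nu i a t))),
      \sum_i integral_rV_vec (cell_set i t1) (fun x => u i x t1) -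
      \sum_i integral_rV_vec (cell_set i t0) (fun x => u i x t0) =
      - \sum_i integral_time t0 t1 (fun t => integral_boundary (cell_mx i t)
            (fun a x => HK i a x t (nu i a t)))
    & forall i j a b t x, i != j -> facet_vertices i a = facet_vertices j b ->
        t0 <= t <= t1 -> facet_set i a t x ->
        nu j b t = - nu i a t /\
        HK i a x t (nu i a t) = - HK j b x t (- nu i a t)].
Proof.
move=> phi u w HK scheme.
have cell_balance i :
    integral_rV_vec (cell_set i t1) (fun x => u i x t1) -
    integral_rV_vec (cell_set i t0) (fun x => u i x t0) =
    - integral_time t0 t1 (fun t => integral_boundary (cell_mx i t)
        (fun a x => HK i a x t (nu i a t))).
  have [_ _ _ [c c0 phi0]] := phihatP.
  have phiE : phi i ord0 = fun=> fun=> c.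
    by apply/funext => x; apply/funext => t; exact: basis_on_cst.
  apply: (scalerI c0); rewrite scalerBr scalerN.
  rewrite -!integral_rV_vecZ -integral_timeZ.
  under [X in - integral_time _ _ X]eq_fun do rewrite -integral_boundaryZ.
  rewrite -[RHS]add0r.
  (* The zero added on the right is the volume term of the scheme, in which the
     gradient of the constant basis function vanishes. *)
  have -> : 0 = integral_time t0 t1 (fun t => integral_rV_vec (cell_set i t)
      (fun x => ale_flux F x t (u i x t) (w i x t) (gradient (fun=> c) x))).
    rewrite -[LHS](integral_time0 N t0 t1); congr integral_time.
    apply/funext => t; rewrite -[LHS](integral_rV_vec0 N (cell_set i t)).
    by congr integral_rV_vec; apply/funext => x; rewrite ale_flux_gradient_cst.
  by have := scheme i ord0; rewrite phiE.
split=> //.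
  by rewrite -sumrB -sumrN; apply: eq_bigr => i _; exact: cell_balance.
move=> i j a b t x ij Fij tP xF.
have nuE : nu j b t = - nu i a t.
  exact: (normal_shared meshT tP ij Fij (nuP _ _ _ tP) (nuP _ _ _ tP)).
split=> //.
have outside r s c e : r != s -> facet_vertices r c = facet_vertices s e ->
    outside_value u ub r c x t = u s x t.
  move=> rs Frs; rewrite /outside_value; case: pickP => [s'|none].
    rewrite /neighbour eq_sym => /andP[rs' /existsP[e' /eqP Fs']].
    by rewrite (neighbour_uniq meshT tP rs rs' Frs (esym Fs')
                  (nuP _ _ _ tP) (nuP _ _ _ tP) (nuP _ _ _ tP)).
  suff : neighbour r c s by rewrite none.
  rewrite /neighbour eq_sym rs /=.
  by apply/existsP; exists e; rewrite Frs.
rewrite /HK (outside _ _ _ _ ij Fij) (outside j i b a) 1?eq_sym//.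
have [nu1 _ _] := nuP i a t tP.
by rewrite H_antisymmetric// /w (mesh_velocity_shared meshT tP Fij xF).
Qed.
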